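(* Let $T:\mathbb{R}^p\to\mathbb{R}^p$ be a non-expansive operator with non-empty fixed-point set, let $z^\star$ be a fixed point of $T$, and set $\ell^{\rm fp}(z)=\|T(z)-z\|_2$ and $\ell^{\rm reg}(z)=\|z-z^\star\|_2$. Let $0\le k<t$ be integers and let $z\in\mathbb{R}^p$. (1) If $T$ is $\beta$-contractive with $\beta\in(0,1)$, then $\ell^{\rm fp}(T^t(z))\le\beta^{t-k}\,\ell^{\rm fp}(T^k(z))$ and $\ell^{\rm fp}(T^t(z))\le 2\beta^{t-k}\,\ell^{\rm reg}(T^k(z))$. (2) If $T$ is $\beta$-linearly convergent with $\beta\in[0,1)$, then $\ell^{\rm fp}(T^t(z))\le \ell^{\rm fp}(T^k(z))$ and $\ell^{\rm fp}(T^t(z))\le 2\beta^{t-k}\,\ell^{\rm reg}(T^k(z))$. (3) If $T$ is $\alpha$-averaged with $\alpha\in(0,1)$, then $\ell^{\rm fp}(T^t(z))\le \ell^{\rm fp}(T^k(z))$ and $$\ell^{\rm fp}(T^t(z))\le\sqrt{\frac{\alpha}{(1-\alpha)(t-k+1)}}\;\ell^{\rm reg}(T^k(z)).$$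
   Context: $T^k$ denotes $k$ applications of $T$, $\mathrm{fix}\,T$ is the set of fixed points of $T$, and $\mathrm{dist}_S(x)=\min_{s\in S}\|s-x\|_2$ for a closed convex set $S$. An operator $T$ is: non-expansive if $\|Tx-Ty\|_2\le\|x-y\|_2$ for all $x,y$; $\beta$-contractive ($\beta\in(0,1)$) if $\|Tx-Ty\|_2\le\beta\|x-y\|_2$ for all $x,y$; $\beta$-linearly convergent ($\beta\in[0,1)$) if $\mathrm{dist}_{\mathrm{fix}\,T}(Tx)\le\beta\,\mathrm{dist}_{\mathrm{fix}\,T}(x)$ for all $x$; $\alpha$-averaged ($\alpha\in(0,1)$) if $T=(1-\alpha)I+\alpha R$ for some non-expansive operator $R$. *)

(* Defs.v *)
From mathcomp Require Import all_boot all_order all_algebra.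
From mathcomp Require Import all_classical all_reals.
Set Implicit Arguments.
Unset Strict Implicit.
Unset Printing Implicit Defensive.
Import Order.TTheory GRing.Theory Num.Theory.
Local Open Scope classical_set_scope.
Local Open Scope ring_scope.

(* The norm [`|x|] of MathComp-Analysis on ['rV[R]_p] is the sup norm, hence
   this separate definition of the Euclidean norm. *)
Definition norm2 (R : realType) (p : nat) (x : 'rV[R]_p) : R :=
  Num.sqrt (\sum_(i < p) x 0 i ^+ 2).

Definition fixpoints (R : realType) (p : nat) (T : 'rV[R]_p -> 'rV[R]_p) :
  set 'rV[R]_p := [set x | T x = x].

(* The minimum is written as an infimum, so that the function is total; it is
   the minimum whenever one exists ([dist2_min]), in particular for nonempty
   closed [S]. *)
Definition dist2 (R : realType) (p : nat) (S : set 'rV[R]_p) (x : 'rV[R]_p) : R :=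
  inf [set norm2 (s - x) | s in S].

Lemma dist2_min (R : realType) (p : nat) (S : set 'rV[R]_p) (x s0 : 'rV[R]_p) :
  S s0 -> (forall s, S s -> norm2 (s0 - x) <= norm2 (s - x)) ->
  dist2 S x = norm2 (s0 - x).
Proof.
move=> Ss0 s0_min; apply/eqP; rewrite eq_le; apply/andP; split.
- apply: ge_inf; last by exists s0.
  by exists 0 => _ [s _ <-]; exact: sqrtr_ge0.
- apply: lb_le_inf; first by exists (norm2 (s0 - x)), s0.
  by move=> _ [s Ss <-]; exact: s0_min.
Qed.

Definition nonexpansive (R : realType) (p : nat) (T : 'rV[R]_p -> 'rV[R]_p) : Prop :=
  forall x y, norm2 (T x - T y) <= norm2 (x - y).

Definition contractive (R : realType) (p : nat) (beta : R)
    (T : 'rV[R]_p -> 'rV[R]_p) : Prop :=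
  forall x y, norm2 (T x - T y) <= beta * norm2 (x - y).

Definition linearly_convergent (R : realType) (p : nat) (beta : R)
    (T : 'rV[R]_p -> 'rV[R]_p) : Prop :=
  forall x, dist2 (fixpoints T) (T x) <= beta * dist2 (fixpoints T) x.

Definition averaged (R : realType) (p : nat) (alpha : R)
    (T : 'rV[R]_p -> 'rV[R]_p) : Prop :=
  exists2 Q : 'rV[R]_p -> 'rV[R]_p,
    nonexpansive Q & forall x, T x = (1 - alpha) *: x + alpha *: Q x.

Definition loss_fp (R : realType) (p : nat) (T : 'rV[R]_p -> 'rV[R]_p)
    (z : 'rV[R]_p) : R := norm2 (T z - z).

Definition loss_reg (R : realType) (p : nat) (zstar z : 'rV[R]_p) : R :=
  norm2 (z - zstar).

(* Main.v *)
Require Import Defs.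
From mathcomp Require Import all_boot all_order all_algebra.
From mathcomp Require Import all_classical all_reals.
From mathcomp Require Import ring lra.
Import Order.TTheory GRing.Theory Num.Theory.
Local Open Scope classical_set_scope.
Local Open Scope ring_scope.

(** The contractive case is immediate. In the linearly convergent case, the
triangle inequality through an arbitrary fixed point bounds the fixed-point
residual by twice the distance to the fixed-point set, and that distance
decays geometrically. In the averaged case, the residual is controlled by the
decrease of the squared distance to the fixed point:
[|T x - z*|^2 + (1 - alpha) / alpha |T x - x|^2 <= |x - z*|^2].
This telescopes along the orbit, and the last residual is the smallest. *)

Lemma norm2_ge0 (R : realType) (p : nat) (x : 'rV[R]_p) : 0 <= norm2 x.
Proof. exact: sqrtr_ge0. Qed.

Lemma norm2_sqr (R : realType) (p : nat) (x : 'rV[R]_p) :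
  norm2 x ^+ 2 = \sum_(i < p) x 0 i ^+ 2.
Proof. by rewrite sqr_sqrtr// sumr_ge0// => i _; rewrite sqr_ge0. Qed.

Lemma norm2_eq0 (R : realType) (p : nat) (x : 'rV[R]_p) : norm2 x = 0 -> x = 0.
Proof.
move=> x0; have := norm2_sqr _ _ x; rewrite x0 expr0n /= => /esym/eqP.
rewrite psumr_eq0 => [/allP x_eq0|i _]; last exact: sqr_ge0.
apply/rowP => i; rewrite mxE; apply/eqP.
by have := x_eq0 i (mem_index_enum i); rewrite sqrf_eq0.
Qed.

Lemma norm2Z (R : realType) (p : nat) (a : R) (x : 'rV[R]_p) :
  norm2 (a *: x) = `|a| * norm2 x.
Proof.
rewrite -sqrtr_sqr -sqrtrM ?sqr_ge0// mulr_sumr.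
by congr Num.sqrt; apply: eq_bigr => i _; rewrite mxE exprMn.
Qed.

Lemma norm2_distC (R : realType) (p : nat) (x y : 'rV[R]_p) :
  norm2 (x - y) = norm2 (y - x).
Proof. by rewrite -opprB -scaleN1r norm2Z normrN1 mul1r. Qed.

(** A polynomial identity in each coordinate. With unit vectors it yields the triangle inequality;
    with [r + s = 1] it is the convex-combination identity behind the averaged case. *)
Lemma norm2_comb_sqr (R : realType) (p : nat) (r s : R) (x y : 'rV[R]_p) :
  norm2 (r *: x + s *: y) ^+ 2 =
  (r + s) * (r * norm2 x ^+ 2 + s * norm2 y ^+ 2) - r * s * norm2 (x - y) ^+ 2.
Proof.
rewrite !norm2_sqr !mulr_sumr -big_split /= mulr_sumr -sumrB.
by apply: eq_bigr => i _; rewrite !mxE; ring.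
Qed.

(** For nonzero [x] and [y] of norms [a] and [b], with unit directions [u] and [v], the squared norm
    of the sum is [(a + b)^2 - a b |u - v|^2]. *)
Lemma ler_norm2D (R : realType) (p : nat) (x y : 'rV[R]_p) :
  norm2 (x + y) <= norm2 x + norm2 y.
Proof.
have [/norm2_eq0 ->|x0] := eqVneq (norm2 x) 0.
  by rewrite add0r lerDr norm2_ge0.
have [/norm2_eq0 ->|y0] := eqVneq (norm2 y) 0.
  by rewrite addr0 lerDl norm2_ge0.
have xE : x = norm2 x *: ((norm2 x)^-1 *: x) by rewrite scalerA mulfV// scale1r.
have yE : y = norm2 y *: ((norm2 y)^-1 *: y) by rewrite scalerA mulfV// scale1r.
have unit (u : 'rV[R]_p) : norm2 u != 0 -> norm2 ((norm2 u)^-1 *: u) = 1.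
  by move=> u0; rewrite norm2Z ger0_norm ?invr_ge0 ?norm2_ge0// mulVf.
rewrite -(@ler_pXn2r _ 2) ?nnegrE ?addr_ge0 ?norm2_ge0//.
rewrite {1}xE {1}yE norm2_comb_sqr !unit// expr1n !mulr1 -expr2 gerBl.
by rewrite !mulr_ge0 ?norm2_ge0 ?sqr_ge0.
Qed.

Lemma ler_norm2_dist (R : realType) (p : nat) (y x z : 'rV[R]_p) :
  norm2 (x - z) <= norm2 (x - y) + norm2 (y - z).
Proof. by rewrite -[x - z](subrKA y) ler_norm2D. Qed.

(** Here [f] is kept general to serve both the residual, with ratio [beta] or 1, and the distance to
    the fixed-point set. *)
Lemma iter_geometric_decay (R : realType) (A : Type) (T : A -> A) (f : A -> R) (b : R) :
  0 <= b -> (forall x, f (T x) <= b * f x) ->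
  forall n x, f (iter n T x) <= b ^+ n * f x.
Proof.
move=> b0 fT; elim=> [|n IHn] x; first by rewrite expr0 mul1r.
by rewrite iterS (le_trans (fT _))// exprS -mulrA ler_wpM2l.
Qed.

Lemma has_lbound_dist2 (R : realType) (p : nat) (S : set 'rV[R]_p) (x : 'rV[R]_p) :
  has_lbound [set norm2 (s - x) | s in S].
Proof. by exists 0 => _ [s _ <-]; exact: norm2_ge0. Qed.

Lemma loss_fp_nonexpansive (R : realType) (p : nat) (T : 'rV[R]_p -> 'rV[R]_p)
    (n : nat) (x : 'rV[R]_p) :
  nonexpansive T -> loss_fp T (iter n T x) <= loss_fp T x.
Proof.
move=> neT; rewrite -[leRHS]mul1r -(expr1n R n).
by apply: iter_geometric_decay => // y; rewrite mul1r; exact: neT.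
Qed.

Lemma loss_fp_le_reg (R : realType) (p : nat) (T : 'rV[R]_p -> 'rV[R]_p)
    (s x : 'rV[R]_p) :
  nonexpansive T -> fixpoints T s -> loss_fp T x <= 2 * norm2 (x - s).
Proof.
move=> neT Ts; rewrite mulr_natl mulr2n.
apply: (le_trans (ler_norm2_dist _ _ s _ _)); rewrite (norm2_distC _ _ s x) lerD2r.
by rewrite -{1}Ts neT.
Qed.

Lemma loss_fp_le_dist2 (R : realType) (p : nat) (T : 'rV[R]_p -> 'rV[R]_p)
    (x : 'rV[R]_p) :
  nonexpansive T -> fixpoints T !=set0 ->
  loss_fp T x <= 2 * dist2 (fixpoints T) x.
Proof.
(* Half the residual is a lower bound of the distances to fixed points, hence at most their
   infimum. *)
move=> neT [s0 Ts0]; rewrite mulrC -ler_pdivrMr//.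
apply: lb_le_inf; first by exists (norm2 (s0 - x)), s0.
move=> _ [s Ts <-]; rewrite ler_pdivrMr// mulrC norm2_distC.
exact: loss_fp_le_reg.
Qed.

Lemma averaged_decrease (R : realType) (p : nat) (T : 'rV[R]_p -> 'rV[R]_p)
    (alpha : R) (s x : 'rV[R]_p) :
  0 < alpha < 1 -> averaged alpha T -> fixpoints T s ->
  (1 - alpha) * loss_fp T x ^+ 2 <=
    alpha * (norm2 (x - s) ^+ 2 - norm2 (T x - s) ^+ 2).
Proof.
move=> /andP[a0 a1] [Q neQ TE] Ts.
(* Cancelling [(1 - alpha) *: s] and then [alpha] in [T s = s] shows that [Q] also fixes [s]. *)
have Qs : Q s = s.
  apply: (scalerI (lt0r_neq0 a0)); apply: (addrI ((1 - alpha) *: s)).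
  by rewrite -TE Ts -scalerDl subrK scale1r.
have Qx : norm2 (Q x - s) ^+ 2 <= norm2 (x - s) ^+ 2.
  by rewrite ler_pXn2r ?nnegrE ?norm2_ge0// -{1}Qs neQ.
have Txs : T x - s = (1 - alpha) *: (x - s) + alpha *: (Q x - s).
  by rewrite TE; apply/rowP => i; rewrite !mxE; ring.
have Txx : T x - x = alpha *: (Q x - x).
  by rewrite TE; apply/rowP => i; rewrite !mxE; ring.
have QxE : x - s - (Q x - s) = x - Q x by rewrite opprB addrA subrK.
rewrite Txs norm2_comb_sqr QxE (norm2_distC _ _ x (Q x)) /loss_fp Txx norm2Z exprMn.
rewrite real_normK ?num_real//.
(* The terms in [norm2 (Q x - x)] agree on both sides; what remains is [Qx] scaled by
   [alpha ^+ 2]. *)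
have := ler_wpM2l (sqr_ge0 alpha) Qx.
lra.
Qed.

Lemma averaged_sum (R : realType) (p : nat) (T : 'rV[R]_p -> 'rV[R]_p)
    (alpha : R) (s : 'rV[R]_p) (n : nat) (x : 'rV[R]_p) :
  0 < alpha < 1 -> averaged alpha T -> fixpoints T s ->
  (1 - alpha) * \sum_(i < n) loss_fp T (iter i T x) ^+ 2 <=
    alpha * (norm2 (x - s) ^+ 2 - norm2 (iter n T x - s) ^+ 2).
Proof.
move=> a01 avT Ts; elim: n => [|n IHn].
  by rewrite big_ord0 /= subrr !mulr0.
rewrite big_ord_recr /= mulrDr.
apply: (le_trans (lerD IHn (averaged_decrease _ _ _ _ _ _ a01 avT Ts))).
by rewrite -mulrDr addrA subrK.
Qed.

Lemma averaged_rate (R : realType) (p : nat) (T : 'rV[R]_p -> 'rV[R]_p)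
    (alpha : R) (s : 'rV[R]_p) (n : nat) (x : 'rV[R]_p) :
  nonexpansive T -> 0 < alpha < 1 -> averaged alpha T -> fixpoints T s ->
  loss_fp T (iter n T x) <=
    Num.sqrt (alpha / ((1 - alpha) * n.+1%:R)) * norm2 (x - s).
Proof.
move=> neT a01 avT Ts; have /andP[a0 a1] := a01.
have b0 : 0 < 1 - alpha by rewrite subr_gt0.
have c0 : 0 < (1 - alpha) * n.+1%:R by rewrite mulr_gt0// ltr0Sn.
rewrite -(@ler_pXn2r _ 2) ?nnegrE ?mulr_ge0 ?sqrtr_ge0 ?norm2_ge0//.
rewrite exprMn (sqr_sqrtr (divr_ge0 (ltW a0) (ltW c0))) mulrAC ler_pdivlMr// mulrC.
(* The residuals at iterates 0 to [n] are [n.+1] in number, each at least the last one; this gives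
   the denominator. *)
apply: (@le_trans _ _ ((1 - alpha) * \sum_(i < n.+1) loss_fp T (iter i T x) ^+ 2)).
  rewrite -mulrA ler_pM2l// mulr_natl -[n.+1 in leLHS]card_ord -sumr_const.
  apply: ler_sum => i _; rewrite ler_pXn2r ?nnegrE ?norm2_ge0//.
  have i_le_n : (i <= n)%N by rewrite -ltnS.
  by rewrite -[in leLHS](subnK i_le_n) iterD loss_fp_nonexpansive.
apply: (le_trans (averaged_sum _ _ _ _ _ _ _ a01 avT Ts)).
by rewrite ler_pM2l// gerBl sqr_ge0.
Qed.

Theorem mainTheorem3 (R : realType) (p : nat) (T : 'rV[R]_p -> 'rV[R]_p)
    (zstar : 'rV[R]_p) (k t : nat) (z : 'rV[R]_p) :
  nonexpansive T -> fixpoints T !=set0 -> fixpoints T zstar -> (k < t)%N ->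
  [/\ forall beta : R, 0 < beta < 1 -> contractive beta T ->
        loss_fp T (iter t T z) <= beta ^+ (t - k) * loss_fp T (iter k T z) /\
        loss_fp T (iter t T z) <= 2 * beta ^+ (t - k) * loss_reg zstar (iter k T z),
      forall beta : R, 0 <= beta < 1 -> linearly_convergent beta T ->
        loss_fp T (iter t T z) <= loss_fp T (iter k T z) /\
        loss_fp T (iter t T z) <= 2 * beta ^+ (t - k) * loss_reg zstar (iter k T z)
    & forall alpha : R, 0 < alpha < 1 -> averaged alpha T ->
        loss_fp T (iter t T z) <= loss_fp T (iter k T z) /\
        loss_fp T (iter t T z) <=
          Num.sqrt (alpha / ((1 - alpha) * (t - k + 1)%:R))
            * loss_reg zstar (iter k T z)].
Proof.
move=> neT fixT Tzstar /ltnW kt.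
(* All bounds depend only on the [t - k] steps of the orbit restarted at [iter k T z]. *)
have -> : iter t T z = iter (t - k) T (iter k T z) by rewrite -iterD subnK.
set x := iter k T z; set n := (t - k)%N.
split=> [b /andP[/ltW b0 _] cT|b /andP[b0 _] lT|a a01 avT].
- have decay : loss_fp T (iter n T x) <= b ^+ n * loss_fp T x.
    by apply: iter_geometric_decay => // y; exact: cT.
  split=> //; apply: (le_trans decay); rewrite mulrAC mulrC.
  by rewrite ler_wpM2r ?exprn_ge0// loss_fp_le_reg.
- split; first exact: loss_fp_nonexpansive.
  apply: (le_trans (loss_fp_le_dist2 _ _ _ _ neT fixT)).
  rewrite -mulrA ler_pM2l//.
  apply: (le_trans (iter_geometric_decay _ _ _ _ _ b0 lT n x)).
  (* Since [zstar] competes in the infimum, the distance to the fixed-point set is at most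
     [loss_reg]. *)
  rewrite ler_wpM2l ?exprn_ge0// /loss_reg norm2_distC.
  by apply: ge_inf; [exact: has_lbound_dist2|exists zstar].
- split; first exact: loss_fp_nonexpansive.
  by rewrite addn1; exact: averaged_rate.
Qed.
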